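(* Let $S$ be an exact (commutative, unital) semiring and let $n\in\mathbb{N}$. Then $\mathcal{R}=\mathcal{R}^*$ in the semigroup $M_n(S)$ of all $n\times n$ matrices over $S$ under multiplication. Thus $M_n(S)$ is abundant if and only if it is regular.
   Context: A semiring is a commutative monoid $(S,+,0)$ with an associative multiplication distributing over addition on both sides and with $0$ absorbing; semirings here are commutative and unital. For $A\in S^{m\times n}$, $\mathrm{Col}(A)\subseteq S^{m\times 1}$ is the $S$-submodule generated by the columns of $A$ and $\mathrm{Row}(A)\subseteq S^{1\times n}$ is the $S$-submodule generated by the rows of $A$. For a set $X\subseteq S^{m\times 1}$ of column vectors, $\mathrm{Ker}(X)=\{(v,v')\in S^{1\times m}\times S^{1\times m}: vx=v'x \text{ for all } x\in X\}$; dually, for a set $X\subseteq S^{1\times n}$ of row vectors, $\mathrm{Ker}(X)=\{(v,v')\in S^{n\times 1}\times S^{n\times 1}: xv=xv' \text{ for all } x\in X\}$. The semiring $S$ is exact if for all $m,n$ and all $A\in S^{m\times n}$: (F1) for each $p$ and each $B\in S^{p\times n}$, $\mathrm{Ker}(\mathrm{Row}(A))\subseteq\mathrm{Ker}(\mathrm{Row}(B))$ if and only if $\mathrm{Row}(B)\subseteq\mathrm{Row}(A)$; (F2) for each $q$ and each $B\in S^{m\times q}$, $\mathrm{Ker}(\mathrm{Col}(A))\subseteq\mathrm{Ker}(\mathrm{Col}(B))$ if and only if $\mathrm{Col}(B)\subseteq\mathrm{Col}(A)$. For a semigroup $T$, let $T^1$ be the monoid obtained by adjoining an identity if necessary. For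 $a,b\in T$: $a\,\mathcal{R}\,b$ iff $aT^1=bT^1$; $a\,\mathcal{R}^*\,b$ iff for all $x,y\in T^1$, $xa=ya\Leftrightarrow xb=yb$; $a\,\mathcal{L}^*\,b$ iff for all $x,y\in T^1$, $ax=ay\Leftrightarrow bx=by$. $T$ is regular if for each $a\in T$ there is $x\in T$ with $axa=a$; $T$ is abundant if every $\mathcal{R}^*$-class and every $\mathcal{L}^*$-class of $T$ contains an idempotent. *)

(* Defs.v *)
From mathcomp Require Import all_boot all_order all_algebra.
From mathcomp Require Import classical_sets.

Set Implicit Arguments.
Unset Strict Implicit.
Unset Printing Implicit Defensive.

Import GRing.Theory.
Local Open Scope ring_scope.
Local Open Scope classical_set_scope.

Section Modules.
Variable S : comPzSemiRingType.

Definition submodule_generated (V : lSemiModType S) (G : set V) : set V :=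
  smallest [set X : set V | GRing.subsemimod_closed (mem X)] G.

Definition Col m n (A : 'M[S]_(m, n)) : set 'cV[S]_m :=
  submodule_generated (range (fun j => col j A)).

Definition Row m n (A : 'M[S]_(m, n)) : set 'rV[S]_n :=
  submodule_generated (range (fun i => row i A)).

Definition KerCol m (X : set 'cV[S]_m) : set ('rV[S]_m * 'rV[S]_m) :=
  [set v | forall x, X x -> v.1 *m x = v.2 *m x].

Definition KerRow n (X : set 'rV[S]_n) : set ('cV[S]_n * 'cV[S]_n) :=
  [set v | forall x, X x -> x *m v.1 = x *m v.2].

(* Null dimensions are allowed; they add no constraint, since the two
   equivalences below hold in every semiring when m, n, p or q is 0. *)
Definition exact_semiring : Prop :=
  forall m n (A : 'M[S]_(m, n)),
    (forall p (B : 'M[S]_(p, n)),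
        KerRow (Row A) `<=` KerRow (Row B) <-> Row B `<=` Row A)
    /\
    (forall q (B : 'M[S]_(m, q)),
        KerCol (Col A) `<=` KerCol (Col B) <-> Col B `<=` Col A).

End Modules.

(* T^1 is rendered by [option T], with [None] acting as the identity. If T
   already has an identity, [None] acts exactly as that element does, so the
   relations below do not depend on whether an identity is really adjoined. *)
Section Semigroups.
Variables (T : Type) (mul : SemiGroup.law T).

Definition mul1l (x : option T) (a : T) : T :=
  if x is Some t then mul t a else a.

Definition mul1r (a : T) (x : option T) : T :=
  if x is Some t then mul a t else a.

Definition greenR (a b : T) : Prop := range (mul1r a) = range (mul1r b).

Definition greenRstar (a b : T) : Prop :=
  forall x y : option T, mul1l x a = mul1l y a <-> mul1l x b = mul1l y b.

Definition greenLstar (a b : T) : Prop :=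
  forall x y : option T, mul1r a x = mul1r a y <-> mul1r b x = mul1r b y.

Definition regular : Prop :=
  forall a : T, exists x : T, mul (mul a x) a = a.

Definition abundant : Prop :=
  forall a : T,
    (exists e : T, greenRstar a e /\ mul e e = e) /\
    (exists e : T, greenLstar a e /\ mul e e = e).

End Semigroups.

Definition matrix_semigroup (S : comPzSemiRingType) (n : nat) :
  SemiGroup.law 'M[S]_n := *%R.

(* Main.v *)
Require Import Defs.
From mathcomp Require Import all_boot all_order all_algebra.
From mathcomp Require Import classical_sets.

(** Left multiplications see a matrix [A] only through the column space
    [Col A], since agreeing on the columns is agreeing on everything they
    generate.  So [R*] says that [Col A] and [Col B] have the same kernel, up to
    one discrepancy: the kernel speaks of pairs of row vectors, whereas [R*]
    speaks of pairs of [n x n] matrices.  Repeating a row vector [n] times turns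
    the first kind of pair into the second ([greenRstar_KerCol]).  The
    column half of exactness recovers a column space from its kernel, so [Col A]
    and [Col B] coincide.  Finally [Col B] lies inside [Col A] precisely when
    [B = A M] for some [M] ([Col_sub_factor]), and mutual right divisibility is
    Green's relation [R].  The converse, that [R] refines [R*], holds in every
    semigroup ([greenR_greenRstar]).

    For the second claim, an element that is [R]-related to an idempotent is
    regular ([greenR_idem_regular]); once [R = R*], the [R*] half of abundance
    therefore gives regularity.  Conversely, if [a x a = a] then [a x] and [x a]
    are idempotents, [R*]- and [L*]-related to [a] in any semigroup
    ([regular_abundant]). *)

Set Implicit Arguments.
Unset Strict Implicit.
Unset Printing Implicit Defensive.

Local Open Scope classical_set_scope.

Section SemigroupFacts.
Variables (T : Type) (mul : SemiGroup.law T).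
Implicit Types (a b e t : T) (x y z : option T).

Lemma mul1l_mul1r x a z :
  mul1l mul x (mul1r mul a z) = mul1r mul (mul1l mul x a) z.
Proof. by case: x z => [x|] [z|] //=; rewrite SemiGroup.opA. Qed.

Lemma greenR_dvd a b :
  greenR mul a b <->
  (exists z, mul1r mul a z = b) /\ (exists z, mul1r mul b z = a).
Proof.
split=> [eq_ab | [[z az] [w bw]]].
  have [z _ az] : range (mul1r mul a) b by rewrite eq_ab; exists None.
  have [w _ bw] : range (mul1r mul b) a by rewrite -eq_ab; exists None.
  by split; [exists z | exists w].
have sub c d u : mul1r mul c u = d -> range (mul1r mul d) `<=` range (mul1r mul c).
  move=> <- _ [v _ <-]; case: u v => [u|] [v|] /=.
  - by exists (Some (mul u v)) => //=; rewrite SemiGroup.opA.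
  - by exists (Some u).
  - by exists (Some v).
  - by exists None.
by apply/seteqP; split; [apply: (sub _ _ w) | apply: (sub _ _ z)].
Qed.

(** An equation [x a = y a] survives multiplication on the right, hence passes
    to every right multiple of [a]. *)
Lemma greenR_greenRstar a b : greenR mul a b -> greenRstar mul a b.
Proof.
move=> /greenR_dvd[[z az] [w bw]] x y; split=> E.
  by rewrite -az !mul1l_mul1r E.
by rewrite -bw !mul1l_mul1r E.
Qed.

(** The idempotent [e] is a left identity on [e T^1], which contains [a]; so
    writing [e = a t] gives [a = e a = a t a]. *)
Lemma greenR_idem_regular a e :
  greenR mul a e -> mul e e = e -> exists t, mul (mul a t) a = a.
Proof.
move=> /greenR_dvd[[z az] [w ew]] ee.
have ea : mul e a = a.
  by rewrite -ew; case: w {ew} => [w|] //=; rewrite SemiGroup.opA ee.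
case: z az => [t|] /= ae; first by exists t; rewrite ae.
by exists a; rewrite ae !ee.
Qed.

Lemma regular_abundant : regular mul -> abundant mul.
Proof.
move=> reg a; have [t ata] := reg a; split.
  exists (mul a t); split; last by rewrite SemiGroup.opA ata.
  apply/greenR_greenRstar/greenR_dvd; split; first by exists (Some t).
  by exists (Some a).
have ata' : mul a (mul t a) = a by rewrite SemiGroup.opA.
have mul_ta x : mul1r mul (mul t a) x = mul t (mul1r mul a x).
  by case: x => [x|] //=; rewrite SemiGroup.opA.
have mul_ata x : mul1r mul a x = mul a (mul1r mul (mul t a) x).
  by rewrite mul_ta; case: x => [x|] /=; rewrite !SemiGroup.opA ata.
exists (mul t a); split; last by rewrite -SemiGroup.opA ata'.
move=> x y; split=> E; first by rewrite !mul_ta E.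
by rewrite !mul_ata E.
Qed.

End SemigroupFacts.

Import GRing.Theory.
Local Open Scope ring_scope.

Section ColumnSpaces.
Variable S : comPzSemiRingType.

Lemma mulmx_col m n p (A : 'M[S]_(m, n)) (B : 'M[S]_(n, p)) j :
  A *m col j B = col j (A *m B).
Proof. by rewrite !colE mulmxA. Qed.

Lemma col_Col m n (A : 'M[S]_(m, n)) j : Col A (col j A).
Proof. by apply: sub_gen_smallest; exists j. Qed.

Lemma Col_min m n (A : 'M[S]_(m, n)) (X : set 'cV[S]_m) :
    X 0 -> (forall x y, X x -> X y -> X (x + y)) ->
    (forall (c : S) x, X x -> X (c *: x)) -> (forall j, X (col j A)) ->
  Col A `<=` X.
Proof.
move=> X0 XD XZ Xcol; apply: smallest_sub => [|_ [j _ <-] //].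
split; first split.
- exact: mem_set.
- by move=> x y /set_mem Xx /set_mem Xy; apply/mem_set/XD.
- by move=> c x /set_mem Xx; apply/mem_set/XZ.
Qed.

Lemma KerColP m n (A : 'M[S]_(m, n)) (v w : 'rV[S]_m) :
  KerCol (Col A) (v, w) <-> v *m A = w *m A.
Proof.
split=> [kerA | eqA].
  apply/matrixP => i j; have /matrixP/(_ i 0) := kerA _ (col_Col j).
  by rewrite !mulmx_col !mxE.
apply: Col_min => [|x y|c x|j] /=.
- by rewrite !mulmx0.
- by rewrite !mulmxDr => -> ->.
- by rewrite -!scalemxAr => ->.
- by rewrite !mulmx_col eqA.
Qed.

(** The vectors [A w] form a subsemimodule containing the columns of [A], so
    each column of [B] is of this form; the vectors [w] are the columns of the
    quotient. *)
Lemma Col_sub_factor m n q (A : 'M[S]_(m, n)) (B : 'M[S]_(m, q)) :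
  Col B `<=` Col A -> exists M : 'M[S]_(n, q), A *m M = B.
Proof.
move=> sBA.
have ColA_mul : Col A `<=` range (mulmx A : 'cV[S]_n -> 'cV[S]_m).
  apply: Col_min => [|_ _ [u _ <-] [w _ <-]|c _ [w _ <-]|j].
  - by exists 0; rewrite // mulmx0.
  - by exists (u + w); rewrite // mulmxDr.
  - by exists (c *: w); rewrite // scalemxAr.
  - by exists (delta_mx j 0); rewrite // -colE.
have /fin_all_exists[w Aw] j : exists w : 'cV[S]_n, A *m w = col j B.
  by have [w _ Aw] := ColA_mul _ (sBA _ (col_Col j)); exists w.
exists (\matrix_(i, j) w j i 0); apply/matrixP => i j.
have /matrixP/(_ i 0) := Aw j; rewrite !mxE => <-.
by apply: eq_bigr => k _; rewrite mxE.
Qed.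

(** A pair of row vectors is tested against [A] and [B] through the square
    matrices all of whose rows equal the given vector. *)
Lemma greenRstar_KerCol n (A B : 'M[S]_n) :
  greenRstar (matrix_semigroup S n) A B ->
  KerCol (Col A) `<=` KerCol (Col B).
Proof.
move=> RsAB [v w] /KerColP vwA; apply/KerColP.
pose rep (u : 'rV[S]_n) : 'M[S]_n := \matrix_(i < n) u.
have row_rep u (C : 'M[S]_n) i : row i (rep u *m C) = u *m C.
  by rewrite row_mul rowK.
have repA : rep v *m A = rep w *m A.
  by apply/row_matrixP => i; rewrite !row_rep.
have repB : rep v *m B = rep w *m B.
  by have [+ _] := RsAB (Some (rep v)) (Some (rep w)); apply.
(* A column index of [B] serves as the row index that [rep] needs, so [n = 0]
   is not a special case. *)
by apply/rowP => j; rewrite -(row_rep v B j) -(row_rep w B j) repB.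
Qed.

(** Exactness enters here only: it turns the inclusion of kernels into an
    inclusion of column spaces, that is, into divisibility. *)
Lemma exact_greenR n (hS : exact_semiring S) (A B : 'M[S]_n) :
  greenR (matrix_semigroup S n) A B <-> greenRstar (matrix_semigroup S n) A B.
Proof.
split=> [|RsAB]; first exact: greenR_greenRstar.
have dvd (C D : 'M[S]_n) : greenRstar (matrix_semigroup S n) C D ->
    exists z, Defs.mul1r (matrix_semigroup S n) C z = D.
  move=> /greenRstar_KerCol kerCD; have [_ /(_ n D)[sDC _]] := hS _ _ C.
  by have [M CM] := Col_sub_factor (sDC kerCD); exists (Some M).
apply/greenR_dvd; split; apply: dvd => //.
by move=> x y; split=> /RsAB.
Qed.

End ColumnSpaces.

Theorem theorem3p5 (S : comPzSemiRingType) (n : nat) (hS : exact_semiring S) :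
  (forall A B : 'M[S]_n,
      greenR (matrix_semigroup S n) A B <-> greenRstar (matrix_semigroup S n) A B)
  /\
  (abundant (matrix_semigroup S n) <-> regular (matrix_semigroup S n)).
Proof.
split=> [A B|]; first exact: exact_greenR.
split=> [abd A|]; last exact: regular_abundant.
have [[E [/(exact_greenR hS) RAE EE]] _] := abd A.
exact: greenR_idem_regular RAE EE.
Qed.
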